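(* Let $0<p\le 1$ and let $L_n$ be the number of items retained by the $p$-percentile rule after $n$ items have been observed. Then there is a constant $c_p$ with $0<c_p<\infty$ such that $E(L_n)/n^p\to c_p$ as $n\to\infty$.
   Context: $X_1,X_2,\ldots$ are i.i.d. real random variables with a continuous distribution. Smaller values are better; $R_n^n=\sum_{j=1}^n I\{X_j\le X_n\}$ is the rank of $X_n$ among $X_1,\ldots,X_n$. For fixed $0<p\le1$ the $p$-percentile rule retains items as follows: $L_0=0$ and the first item is retained ($L_1=1$); for $n\ge 2$, $X_n$ is retained if and only if $R_n^n\le\lceil pL_{n-1}\rceil$, where $L_{n}$ denotes the number of items retained among the first $n$ (so $L_n=L_{n-1}+1$ if $X_n$ is retained and $L_n=L_{n-1}$ otherwise). $\lceil x\rceil$ is the smallest integer $\ge x$. *)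

(* Defs.v *)
From HB Require Import structures.
From mathcomp Require Import all_boot all_order all_algebra finmap.
From mathcomp Require Import all_classical all_reals all_analysis.

Set Implicit Arguments.
Unset Strict Implicit.
Unset Printing Implicit Defensive.

Import Order.TTheory GRing.Theory Num.Theory.
Import numFieldNormedType.Exports.

Local Open Scope classical_set_scope.
Local Open Scope ring_scope.

(* Mutual independence: the product rule over every finite subfamily. *)
Definition mutually_independent (R : realType) (d : measure_display)
    (T : measurableType d) (P : probability T R) (I : choiceType)
    (X : I -> {RV P >-> R}) : Prop :=
  forall (J : {fset I}) (A : I -> set R),
    (forall i, measurable (A i)) ->
    P (\bigcap_(i in [set` J]) (X i @^-1` A i))
    = (\prod_(i <- J) P (X i @^-1` A i))%E.

Definition identically_distributed (R : realType) (d : measure_display)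
    (T : measurableType d) (P : probability T R) (I : Type)
    (X : I -> {RV P >-> R}) : Prop :=
  forall (i j : I) (A : set R),
    measurable A -> distribution P (X i) A = distribution P (X j) A.

Definition continuous_distribution (R : realType) (d : measure_display)
    (T : measurableType d) (P : probability T R) (X : {RV P >-> R}) : Prop :=
  continuous (cdf X).

(* Sequences are indexed from 0: [x n] is the (n+1)-st item observed, and
   [rank x n] is its rank among the first n+1 items. *)
Definition rank (R : realType) (x : nat -> R) (n : nat) : nat :=
  (\sum_(j < n.+1) (x j <= x n)%R)%N.

(* [num_retained p x n] is the number of items the p-percentile rule retains
   among the first n items [x 0], ..., [x n.-1]; the very first item is always
   retained. *)
Fixpoint num_retained (R : realType) (p : R) (x : nat -> R) (n : nat) : nat :=
  if n is m.+1 then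
    let l := num_retained p x m in
    if (m == 0)%N || ((rank x m)%:Z <= Num.ceil (p * l%:R)) then l.+1 else l
  else 0%N.

(* Main.v *)
(* On a sample without ties the rule sees only the relative order, which by
   exchangeability is a uniformly distributed permutation; hence
   [e_n = E L_n] is the average of [L_n] over ['S_n].  Splitting a permutation
   according to the rank of its last entry gives
     [e_n = e_(n-1) + E (ceil (p L_(n-1))) / n],
   so [e_(n-1) (1 + p/n) <= e_n <= e_(n-1) (1 + p/n) + 1/n].  By Bernoulli's
   inequality [((n+1)/n)^p <= 1 + p/n <= (n/(n-1))^p], which makes
   [e_n / (n+1)^p] nondecreasing and [(e_n + 1/p) / n^p] nonincreasing; the two
   monotonicities give convergence and positivity of the limit. *)

Require Import Defs.
From HB Require Import structures.
From mathcomp Require Import all_boot all_order all_algebra.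
From mathcomp Require Import all_fingroup finmap zify ring lra.
From mathcomp Require Import all_classical all_reals all_analysis.
From mathcomp Require Import measurable_realfun.

Set Implicit Arguments.
Unset Strict Implicit.
Unset Printing Implicit Defensive.

Import Order.TTheory GRing.Theory Num.Theory.
Import numFieldNormedType.Exports.

Local Open Scope classical_set_scope.
Local Open Scope ring_scope.

(** * Dependence of the rule on the relative order alone *)

Lemma eq_rank (R : realType) (x y : nat -> R) (n : nat) :
  (forall j, (j <= n)%N -> (x j <= x n) = (y j <= y n)) ->
  rank x n = rank y n.
Proof. by move=> xy; apply: eq_bigr => j _; rewrite xy// -ltnS. Qed.

Lemma eq_num_retained (R : realType) (p : R) (x y : nat -> R) (n : nat) :
  (forall i j, (i < n)%N -> (j < n)%N -> (x i <= x j) = (y i <= y j)) ->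
  num_retained p x n = num_retained p y n.
Proof.
elim: n => // n IHn xy /=.
rewrite IHn => [|i j lti ltj]; last by rewrite xy ?ltnS// ltnW.
by rewrite (@eq_rank _ x y)// => j lejn; rewrite xy.
Qed.

Lemma num_retained_le (R : realType) (p : R) (x : nat -> R) (n : nat) :
  (num_retained p x n <= n)%N.
Proof. by elim: n => //= n IHn; case: ifP => _; rewrite ?ltnS// leqW. Qed.

(** * Sums over permutations and the recurrence for [L_n] *)

(** The rule acts on infinite sequences, so [s] is padded with the default 0; only entries of index
    below [n] are ever read. *)
Definition perm_seq (R : realType) (n : nat) (s : 'S_n) (i : nat) : R :=
  oapp (fun j : 'I_n => (s j)%:R) 0 (insub i).

Lemma perm_seqE (R : realType) (n : nat) (s : 'S_n) (i : 'I_n) :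
  perm_seq R s i = (s i)%:R.
Proof. by rewrite /perm_seq valK. Qed.

(** [lift_perm ord_max r t] puts [r] last and shifts the values of [t] past [r], a strictly
    increasing operation that preserves all comparisons. *)
Lemma perm_seq_lift (R : realType) (n : nat) (r : 'I_n.+1) (t : 'S_n)
    (i j : nat) : (i < n)%N -> (j < n)%N ->
  let s := lift_perm ord_max r t in
  (perm_seq R s i <= perm_seq R s j) = (perm_seq R t i <= perm_seq R t j).
Proof.
move=> lti ltj s; pose i' := Ordinal lti; pose j' := Ordinal ltj.
have -> : i = lift ord_max i' by rewrite lift_max.
have -> : j = lift ord_max j' by rewrite lift_max.
rewrite !perm_seqE !lift_max !perm_seqE !lift_perm_lift !ler_nat.
by rewrite /= leq_bump2.
Qed.

Lemma sum_ltn_ord (n m : nat) : (\sum_(k < n) (k < m) = minn n m)%N.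
Proof.
by elim: n => [|n IHn]; rewrite ?big_ord0 ?big_ord_recr /= ?IHn; lia.
Qed.

Lemma rank_perm_seq (R : realType) (n : nat) (s : 'S_n.+1) :
  rank (perm_seq R s) n = (s ord_max).+1.
Proof.
transitivity (minn n.+1 (s ord_max).+1); last exact/minn_idPr.
rewrite -sum_ltn_ord (reindex_perm s) /=.
rewrite /rank; apply: eq_bigr => j _.
by rewrite perm_seqE -[n in perm_seq _ _ n]/(val (@ord_max n)) perm_seqE ler_nat.
Qed.

(** A permutation amounts to its last value [r] and the pattern [t] of its other entries.
    Injectivity suffices for bijectivity, as both sides have [(n+1)!] elements. *)
Lemma sum_lift_perm (V : nmodType) (n : nat) (F : 'S_n.+1 -> V) :
  \sum_s F s = \sum_(t : 'S_n) \sum_(r : 'I_n.+1) F (lift_perm ord_max r t).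
Proof.
have inj : injective (fun rt : 'S_n * 'I_n.+1 => lift_perm ord_max rt.2 rt.1).
  move=> [t1 r1] [t2 r2] /= eq_lift.
  have eqr : r1 = r2.
    by have /permP/(_ ord_max) := eq_lift; rewrite !lift_perm_id.
  rewrite eqr in eq_lift *; congr pair; apply/permP => k.
  have /permP/(_ (lift ord_max k)) := eq_lift.
  by rewrite !lift_perm_lift => /lift_inj.
rewrite pair_bigA (reindex (fun rt : 'S_n * 'I_n.+1 => lift_perm ord_max rt.2 rt.1)) //=.
apply: onW_bij; apply: inj_card_bij => //.
by rewrite card_prod !card_Sn card_ord factS mulnC.
Qed.

(* The last entry [r] of a permutation of [n.+2] items is retained iff
   [r < ceil (p l)], which holds for [ceil (p l)] of the [n.+2] values of [r]. *)
Lemma sum_num_retained_rec (R : realType) (p : R) (n : nat) :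
  0 < p <= 1 ->
  \sum_(s : 'S_n.+2) (num_retained p (perm_seq R s) n.+2)%:R =
  \sum_(t : 'S_n.+1) (n.+2%:R * (num_retained p (perm_seq R t) n.+1)%:R
    + (Num.ceil (p * (num_retained p (perm_seq R t) n.+1)%:R))%:~R) :> R.
Proof.
move=> /andP[p_gt0 p_le1]; rewrite sum_lift_perm; apply: eq_bigr => t _.
set l := num_retained p (perm_seq R t) n.+1.
have l_le : (l <= n.+1)%N by exact: num_retained_le.
have : 0 <= Num.ceil (p * l%:R).
  by rewrite ceil_ge0 (lt_le_trans (ltrN10 _))// mulr_ge0// ltW.
have : Num.ceil (p * l%:R) <= l%:Z.
  by rewrite ceil_le_int ler_piMl.
(* Nonnegativity makes the ceiling a natural number [c]; moreover [c <= l <= n.+1], so the count of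
   [r < c] below is not truncated. *)
case ceilE: (Num.ceil (p * l%:R)) => [c|] //; rewrite lez_nat => c_le _.
transitivity (\sum_(r < n.+2) ((l + (r < c))%N)%:R : R).
  apply: eq_bigr => r _; congr _%:R.
  set x := perm_seq R _.
  rewrite -[LHS]/(let m := num_retained p x n.+1 in
    if (n.+1 == 0)%N || ((rank x n.+1)%:Z <= Num.ceil (p * m%:R))
    then m.+1 else m).
  have -> : num_retained p x n.+1 = l.
    by apply: eq_num_retained => i j lti ltj; rewrite perm_seq_lift.
  rewrite rank_perm_seq lift_perm_id /= ceilE lez_nat.
  by case: ltnP; rewrite (addn0, addn1).
rewrite -natr_sum big_split /= sum_nat_const card_ord sum_ltn_ord.
have -> : minn n.+2 c = c by lia.
by rewrite natrD natrM.
Qed.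

(** * Bernoulli's inequality and the limit of the recurrence *)

(** Concavity of [ln] between [1 + x] and [1], with weights [p] and [1 - p], gives
    [p ln (1 + x) <= ln (1 + p x)]. *)
Lemma powR1D_le (R : realType) (p x : R) : 0 <= p <= 1 -> -1 < x ->
  (1 + x) `^ p <= 1 + p * x.
Proof.
move=> p01 x_gt; have x1 : 0 < 1 + x by lra.
have [p0 p1] := andP p01.
have := @concave_ln R (Itv01 p0 p1) (1 + x) 1 x1 ltr01.
rewrite ln1 !convRE /= mulr0 addr0 /unstable.onem => ln_le.
have px : 0 < 1 + p * x.
  have [->|p_neq1] := eqVneq p 1; first by lra.
  have p_lt1 : p < 1 by rewrite lt_neqAle p_neq1.
  by have := mulr_ge0 p0 (ltW x1); lra.
rewrite -(@ler_ln R) ?posrE ?powR_gt0// ln_powR (le_trans ln_le)//.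
by rewrite le_eqVlt; apply/orP; left; apply/eqP; congr ln; lra.
Qed.

Lemma cvg_powR_pinfty (R : realType) (p : R) : 0 < p ->
  (n.+1%:R `^ p : R) @[n --> \oo] --> +oo.
Proof.
move=> p0; apply/cvgryPge => A.
near=> n.
have An : `|A| `^ p^-1 <= n.+1%:R.
  apply: (@le_trans _ _ n%:R); last by rewrite ler_nat.
  by near: n; exact: nbhs_infty_ger.
have AE : `|A| = (`|A| `^ p^-1) `^ p.
  by rewrite -powRrM mulVf ?lt0r_neq0// powRr1.
rewrite (le_trans (ler_norm A))// AE ge0_ler_powR ?nnegrE ?powR_ge0//.
exact: ltW.
Unshelve. all: by end_near. Qed.

(** Bernoulli's inequality rescaled by [N]; it is applied with [h = -1] and [h = 1]. *)
Lemma powRD_le (R : realType) (p h N : R) : 0 <= p <= 1 -> 0 < N ->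
  0 < N + h -> (N + h) `^ p <= (1 + p * (h / N)) * N `^ p.
Proof.
move=> p01 N0 Nh.
have -> : N + h = (1 + h / N) * N by field; rewrite lt0r_neq0.
have hN : -1 < h / N by rewrite ltr_pdivlMr//; lra.
rewrite powRM ?(ltW N0)//; last by lra.
by rewrite ler_wpM2r ?powR_ge0// powR1D_le.
Qed.

Lemma growth_limit (R : realType) (p : R) (e : nat -> R) :
  0 < p <= 1 -> 0 < e 1%N ->
  (forall n, e n.+1 * (1 + p / n.+2%:R) <= e n.+2
             <= e n.+1 * (1 + p / n.+2%:R) + n.+2%:R^-1) ->
  exists2 c : R, 0 < c & (e n / n%:R `^ p) @[n --> \oo] --> c.
Proof.
move=> /andP[p0 p1] e1 e_rec.
have pw n : 0 < n.+1%:R `^ p :> R by rewrite powR_gt0.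
have e_gt0 n : 0 < e n.+1.
  elim: n => // n IHn; have /andP[+ _] := e_rec n; apply: lt_le_trans.
  by rewrite mulr_gt0// addr_gt0// divr_gt0.
pose a n := (e n.+1 + p^-1) / n.+1%:R `^ p.
pose b n := e n.+1 / n.+2%:R `^ p.
have p01 : 0 <= p <= 1 by rewrite ltW.
have le_ratio (x y u v : R) : 0 < u -> 0 < v -> x * v <= y * u -> x / u <= y / v.
  by move=> u0 v0 xvyu; rewrite ler_pdivrMr// mulrAC ler_pdivlMr.
have a_noninc : nonincreasing_seq a.
  apply/nonincreasing_seqP => n; rewrite /a.
  set N : R := n.+2%:R; have N0 : 0 < N by [].
  have nN : n.+1%:R = N + -1 by rewrite /N -[n.+2]addn1 natrD addrK.
  have := @powRD_le R p (-1) N p01 N0; rewrite -nN => /(_ (ltr0Sn _ _)) pow_le.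
  have /andP[_ e_le] := e_rec n; rewrite -/N in e_le.
  apply: le_ratio; [exact: pw|exact: pw|].
  have pN : 0 < p / N by rewrite divr_gt0.
  have pV : 0 < p^-1 by rewrite invr_gt0.
  (* The shift by [1/p] absorbs the additive error, since [p^-1 * (p / N) = 1 / N]. *)
  have e_le' : e n.+2 + p^-1 <= (e n.+1 + p^-1) * (1 + p / N).
    rewrite (le_trans (lerD e_le (lexx _)))// le_eqVlt; apply/orP; left.
    by apply/eqP; field; rewrite !lt0r_neq0.
  have NV : p * (-1 / N) = - (p / N) by field; rewrite lt0r_neq0.
  rewrite NV in pow_le.
  apply: (@le_trans _ _ ((e n.+1 + p^-1) * (1 + p / N) * n.+1%:R `^ p)).
    by rewrite ler_wpM2r// ltW.
  rewrite -mulrA; apply: ler_wpM2l; first by rewrite addr_ge0// ltW.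
  (* The case [h = -1] bounds [(N - 1)^p] by [(1 - p/N) N^p]; it then remains to use
     [(1 + q) (1 - q) <= 1] with [q = p/N]. *)
  apply: (@le_trans _ _ ((1 + p / N) * ((1 - p / N) * N `^ p))).
    by rewrite ler_wpM2l// addr_ge0// ltW.
  rewrite mulrA -[leRHS]mul1r; apply: ler_wpM2r; first exact: powR_ge0.
  by move: (p / N) => q; have := sqr_ge0 q; lra.
have b_nondec : nondecreasing_seq b.
  apply/nondecreasing_seqP => n; rewrite /b.
  set N : R := n.+2%:R; have N0 : 0 < N by [].
  have nN : n.+3%:R = N + 1 by rewrite /N -[n.+3]addn1 natrD.
  have := @powRD_le R p 1 N p01 N0; rewrite -nN => /(_ (ltr0Sn _ _)).
  rewrite div1r => pow_le.
  have /andP[e_ge _] := e_rec n; rewrite -/N in e_ge.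
  apply: le_ratio; [exact: pw|exact: pw|].
  apply: (@le_trans _ _ (e n.+1 * ((1 + p / N) * N `^ p))).
    by rewrite ler_wpM2l// ltW.
  by rewrite mulrA ler_wpM2r// powR_ge0.
have a_cvg : cvgn a.
  apply: nonincreasing_is_cvgn => //; exists 0 => _ [n _ <-].
  by rewrite divr_ge0 ?addr_ge0 ?invr_ge0// ltW.
(* The ratio differs from [a n] by [p^-1 / (n+1)^p], which tends to 0. *)
have e_cvg : (e n.+1 / n.+1%:R `^ p) @[n --> \oo] --> limn a.
  rewrite [X in X @ _](_ : _ = (fun n => a n - p^-1 * (n.+1%:R `^ p)^-1)); last first.
    by apply/funext => n; rewrite /a -mulrBl addrK.
  rewrite -[limn a]subr0; apply: cvgB => //.
  rewrite -[0](mulr0 p^-1); apply: cvgMr.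
  apply/gtr0_cvgV0; last exact: cvg_powR_pinfty.
  by near=> n; rewrite pw.
exists (limn a); last by rewrite -cvg_shiftS.
(* Each ratio dominates [b n], whose denominator is larger, so the limit is at least
   [b 0 = e 1 / 2^p > 0]. *)
apply: (@lt_le_trans _ _ (b 0%N)); first by rewrite divr_gt0.
rewrite -(cvg_lim _ e_cvg)//; apply: limr_ge; first by apply/cvg_ex; exists (limn a).
near=> n.
apply: (le_trans (b_nondec 0%N n (leq0n n))).
by rewrite ler_pM2l// lef_pV2 ?posrE// ge0_ler_powR ?nnegrE ?ltW// ltr_nat.
Unshelve. all: by end_near. Qed.

(** * The relative order of a vector as a permutation *)

(** Here [s i] is the rank of [x i] counted from 0. As [s] is injective, a vector with ties
    satisfies this for no [s]. *)
Definition same_order (R : realType) (n : nat) (x : 'I_n -> R) (s : 'S_n) :=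
  forall i j, (x i <= x j) = (s i <= s j)%N.

(** The value [s i] is the number of [j] with [x j < x i], hence is determined by [x]. *)
Lemma same_order_inj (R : realType) (n : nat) (x : 'I_n -> R) (s t : 'S_n) :
  same_order x s -> same_order x t -> s = t.
Proof.
move=> xs xt; apply/permP => i; apply: val_inj.
have perm_rank (u : 'S_n) : (\sum_(j < n) (u j < u i) = u i)%N.
  transitivity (minn n (u i)); last by apply/minn_idPr; exact: ltnW.
  by rewrite -sum_ltn_ord [RHS](reindex_perm u).
rewrite /= -(perm_rank s) -(perm_rank t); apply: eq_bigr => j _.
by rewrite !ltnNge -xs -xt.
Qed.

Lemma same_order_exists (R : realType) (n : nat) (x : 'I_n -> R) :
  injective x -> exists s, same_order x s.
Proof.
move=> x_inj; pose rk i := (\sum_(j < n) (x j < x i)%R)%N.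
have rk_lt i : (rk i < n)%N.
  rewrite /rk (bigD1 i)//= ltxx add0n.
  apply: (@leq_ltn_trans (\sum_(j < n | j != i) 1)%N).
    by apply: leq_sum => j _; case: (_ < _).
  by rewrite sum1_card (cardC1 i) card_ord ltn_predL (leq_ltn_trans _ (ltn_ord i)).
have rk_le i j : (rk i <= rk j)%N = (x i <= x j).
  have homo k l : x k <= x l -> (rk k <= rk l)%N.
    move=> xkl; apply: leq_sum => m _; case: (ltP (x m) (x k)) => // xmk.
    by rewrite (lt_le_trans xmk).
  apply/idP/idP; last exact: homo.
  (* If [x j < x i], then [j] itself is counted in [rk i] but not in [rk j]. *)
  apply: contraTT; rewrite -ltNge -ltnNge => xji.
  rewrite /rk (bigD1 j)//= [X in (_ < X)%N](bigD1 j)//= ltxx xji add0n add1n ltnS.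
  apply: leq_sum => m _; case: (ltP (x m) (x j)) => // xmj.
  by rewrite (lt_trans xmj).
have rk_inj : injective (fun i => Ordinal (rk_lt i)).
  move=> i j [rkij]; apply: x_inj; apply: le_anti.
  by rewrite -!rk_le rkij leqnn.
by exists (perm rk_inj) => i j; rewrite !permE /= rk_le.
Qed.

Lemma num_retained_same_order (R : realType) (p : R) (n : nat) (x : nat -> R)
    (s : 'S_n) : same_order (fun i : 'I_n => x i) s ->
  num_retained p x n = num_retained p (perm_seq R s) n.
Proof.
move=> xs; apply: eq_num_retained => i j lti ltj.
have := xs (Ordinal lti) (Ordinal ltj).
by rewrite /= => ->; rewrite -[i]/(val (Ordinal lti)) -[j]/(val (Ordinal ltj))
  !perm_seqE ler_nat.
Qed.

(** Measurable boxes: a family closed under intersection that generates the product sigma-algebra on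
    [R^n]. *)
Definition cylinder (R : realType) (n : nat) : set (set ('I_n -> R)) :=
  [set S | exists2 A : 'I_n -> set R, (forall i, measurable (A i)) &
                   S = [set x | forall i, A i (x i)]].

Lemma setI_closed_cylinder (R : realType) (n : nat) :
  setI_closed (@cylinder R n).
Proof.
move=> _ _ [A mA ->] [B mB ->]; exists (fun i => A i `&` B i).
  by move=> i; exact: measurableI.
by apply/seteqP; split=> x /= => [[xA xB] i|xAB]; [|split=> i; have [] := xAB i].
Qed.

Lemma measurable_same_order (R : realType) (n : nat) (s : 'S_n) :
  <<s @cylinder R n >> [set x | same_order x s].
Proof.
pose U := g_sigma_algebraType (@cylinder R n).
have mcoord (i : 'I_n) : measurable_fun [set: U] (fun x : U => x i).
  move=> _ A mA; rewrite setTI; apply: sub_sigma_algebra.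
  (* A box whose only restricted side is the [i]-th. *)
  exists (fun j => if j == i then A else setT).
    by move=> j; case: ifP.
  apply/seteqP; split=> x /= => [xA j|/(_ i)]; last by rewrite eqxx.
  by case: eqP => // ->.
have -> : [set x : 'I_n -> R | same_order x s] =
    \bigcap_(ij in [set: 'I_n * 'I_n])
      [set x : U | (x ij.1 <= x ij.2) = (s ij.1 <= s ij.2)%N].
  apply/seteqP; split => x /= => [xs ij _|xs i j]; first exact: xs.
  exact: (xs (i, j)).
apply: (@fin_bigcap_measurable _ U) => //.
move=> [i j] _ /=.
have /(_ measurableT [set (s i <= s j)%N]) := measurable_fun_ler (mcoord i) (mcoord j).
by rewrite setTI; apply.
Qed.

(** * Exchangeability and absence of ties in an i.i.d. sample *)

Section iid.
Context (R : realType) (d : measure_display) (T : measurableType d)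
  (P : probability T R) (X : nat -> {RV P >-> R}).
Hypothesis X_indep : mutually_independent X.
Hypothesis X_id : identically_distributed X.
Hypothesis X_cont : forall n, continuous_distribution (X n).

Lemma prob_cylinder (n : nat) (f : 'I_n -> nat) (A : 'I_n -> set R) :
  injective f -> (forall i, measurable (A i)) ->
  P [set w | forall i, A i (X (f i) w)] =
  (\prod_(i < n) distribution P (X 0%N) (A i))%E.
Proof.
move=> f_inj mA.
(* Independence wants sets indexed by [nat]: [B] carries [A] along [f], and is the full set off the
   range of [f]. *)
pose B j := \bigcap_(i in [set i | f i = j]) A i.
have fB i : B (f i) = A i.
  apply/seteqP; split => [x xB|x xA k /= /f_inj ->//]; exact: xB.
have mB j : measurable (B j).
  exact: fin_bigcap_measurable.
pose J := seq_fset tt [seq f i | i <- enum 'I_n].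
have -> : [set w | forall i, A i (X (f i) w)] =
    \bigcap_(j in [set` J]) (X j @^-1` B j).
  apply/seteqP; split => w /= => [wA j|wB i].
    by rewrite /= seq_fsetE => /mapP[i _ ->]; rewrite fB; exact: wA.
  by rewrite -fB; apply: wB; rewrite /= seq_fsetE map_f// mem_enum.
rewrite X_indep// (perm_big [seq f i | i <- enum 'I_n]); last first.
  apply: uniq_perm; first exact: fset_uniq.
    by rewrite map_inj_uniq ?enum_uniq.
  by move=> j; rewrite seq_fsetE.
rewrite big_map big_enum; apply: eq_bigr => i _.
by rewrite fB; exact: X_id.
Qed.

(** Dynkin's argument: on boxes both probabilities are the same product of marginals, and the good
    sets form a Dynkin system. Measurability is part of the conclusion because complements and
    unions need it. *)
Lemma exchangeable (n : nat) (f g : 'I_n -> nat) (S : set ('I_n -> R)) :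
  injective f -> injective g -> <<s @cylinder R n >> S ->
  [/\ measurable [set w | S (fun i => X (f i) w)],
      measurable [set w | S (fun i => X (g i) w)] &
      P [set w | S (fun i => X (f i) w)] = P [set w | S (fun i => X (g i) w)]].
Proof.
move=> f_inj g_inj; rewrite -setI_closed_g_dynkin_g_sigma_algebra; last first.
  exact: setI_closed_cylinder.
pose H := [set S : set ('I_n -> R) |
  [/\ measurable [set w | S (fun i => X (f i) w)],
      measurable [set w | S (fun i => X (g i) w)] &
      P [set w | S (fun i => X (f i) w)] = P [set w | S (fun i => X (g i) w)]]].
suff : <<d @cylinder R n >> `<=` H by exact.
apply: smallest_sub.
  split.
  - by split => //; exact: measurableT.
  - move=> A [mf mg eqP]; split; [exact: measurableC|exact: measurableC|].
    by rewrite !probability_setC//; congr (1 - _)%E.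
  - move=> F tF HF; have mf k : measurable [set w | F k (fun i => X (f i) w)].
      by have [] := HF k.
    have mg k : measurable [set w | F k (fun i => X (g i) w)].
      by have [] := HF k.
    split; [exact: bigcupT_measurable mf|exact: bigcupT_measurable mg|].
    have tI (h : 'I_n -> nat) :
        trivIset [set: nat] (fun k => [set w | F k (fun i => X (h i) w)]).
      apply/trivIsetP => k l _ _ kl; apply/seteqP; split => // w /= [wk wl].
      have /trivIsetP/(_ k l I I kl) := tF.
      by move/seteqP => [+ _] => /(_ (fun i => X (h i) w)); apply.
    rewrite (measure_bigcup P _ _ (fun k _ => mf k) (tI f)).
    rewrite (measure_bigcup P _ _ (fun k _ => mg k) (tI g)).
    by apply: eq_eseriesr => k _; have [] := HF k.
move=> _ [A mA ->].
have mA_X (h : 'I_n -> nat) : measurable [set w | forall i, A i (X (h i) w)].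
  rewrite (_ : [set w | _] = \bigcap_(i in [set: 'I_n]) (X (h i) @^-1` A i)).
    by apply: fin_bigcap_measurable => // i _; exact: measurable_funPTI.
  by apply/seteqP; split => w /= wA i; [move=> _|]; exact: wA.
split; [exact: mA_X|exact: mA_X|].
exact: etrans (prob_cylinder f_inj mA) (esym (prob_cylinder g_inj mA)).
Qed.

(** By independence the pair has the product law; the sections of the diagonal are points, which are
    null because the cdf is continuous. *)
Lemma prob_eq0 (i j : nat) : i != j -> P [set w | X i w = X j w] = 0%E.
Proof.
move=> ij; pose Z w := (X i w, X j w).
have mZ : measurable_fun [set: T] Z by exact: measurable_fun_pair.
have prob_pt (k : nat) (r : R) : distribution P (X k) [set r] = 0%E.
  (* An atom at [r] would be a jump of the cdf: let [r - 1/(n+1)] increase to [r]. *)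
  have le_cdf n :
      (cdf (X k) (r - harmonic n)%R + distribution P (X k) [set r] <= cdf (X k) r)%E.
    rewrite /cdf -measureU//; last first.
      apply/seteqP; split => // x /= [+ xr]; rewrite xr in_itv /= leNgt.
      by rewrite ltrBlDr ltrDl harmonic_gt0.
    apply: le_measure; rewrite ?inE; [exact: measurableU|exact: measurable_itv|].
    move=> x /= [|->]; rewrite !in_itv //= => /le_trans; apply.
    by rewrite lerBlDr lerDl ltW// harmonic_gt0.
  have fin_cdf x : cdf (X k) x \is a fin_num by exact: fin_num_measure.
  have r_cvg : (r - harmonic n) @[n --> \oo] --> r - 0.
    by apply: cvgB; [exact: cvg_cst|exact: cvg_harmonic].
  rewrite subr0 in r_cvg.
  have : (cdf (X k) (r - harmonic n)%R + distribution P (X k) [set r])%E @[n --> \oo]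
      --> (cdf (X k) r + distribution P (X k) [set r])%E.
    apply: cvgeD; [by rewrite fin_num_adde_defr|  |exact: cvg_cst].
    exact: (cvg_comp _ _ r_cvg (@X_cont k r)).
  move=> cdf_cvg.
  have : (cdf (X k) r + distribution P (X k) [set r] <= cdf (X k) r)%E.
    rewrite -(cvg_lim _ cdf_cvg)//; apply: lime_le.
      by apply/cvg_ex; eexists; exact: cdf_cvg.
    by near=> n; exact: le_cdf.
  rewrite -[leRHS]adde0 leeD2lE// => le0.
  by apply/eqP; rewrite eq_le le0 measure_ge0.
pose D := [set xy : R * R | xy.1 = xy.2].
have mD : measurable D.
  have /(_ measurableT [set true]) :=
    @measurable_fun_eqr _ _ R setT (@fst R R) (@snd R R)
      measurable_fst measurable_snd.
  rewrite setTI (_ : _ @^-1` _ = D); first by apply.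
  by apply/seteqP; split => -[x y] /= /eqP.
rewrite -[LHS]/(pushforward P Z D).
pose Zm := [the {mfun T >-> (R * R)%type} of mfun_Sub (mem_set mZ)].
rewrite -[LHS]/(distribution P Zm D).
rewrite -(@product_measure_unique _ _ _ _ R (distribution P (X i))
  (distribution P (X j)) (distribution P Zm))//.
  rewrite /product_measure1 integral0_eq// => x _ /=.
  rewrite -[RHS](prob_pt j x); congr (distribution _ _ _).
  by apply/seteqP; split => y /=; rewrite /xsection /= inE /D /= => ->.
(* The product rule on rectangles, which identifies the law of the pair, is independence over the
   subfamily [{i, j}]. *)
move=> A B mA mB.
have := X_indep [fset i; j]%fset (A := fun k => if k == i then A else B).
rewrite big_fsetU1 ?inE//= big_seq_fset1 eqxx eq_sym (negbTE ij) => <-; last first.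
  by move=> k; case: ifP.
congr (P _); apply/seteqP; split => w /=.
  by move=> [XA XB] k /=; rewrite !inE => /orP[] /eqP ->;
    rewrite ?eqxx// eq_sym (negbTE ij).
move=> AB; split.
  by have := AB i; rewrite /= !inE eqxx => /(_ isT).
by have := AB j; rewrite /= !inE eqxx orbT eq_sym (negbTE ij) => /(_ isT).
Unshelve. all: by end_near. Qed.

(** * Uniformity of the relative order and the expectation of [L_n] *)

Definition order_event (n : nat) (s : 'S_n) : set T :=
  [set w | same_order (fun i : 'I_n => X i w) s].

Lemma order_event_exchange (n : nat) (s : 'S_n) :
  measurable (order_event s) /\ P (order_event s) = P (order_event (1%g : 'S_n)).
Proof.
(* Reading the sample along the inverse of [s] turns the order [s] into the identity order. *)
have s_inj : injective (fun i => val (s^-1%g i)).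
  by move=> i j /val_inj /perm_inj.
have [] := exchangeable s_inj val_inj (@measurable_same_order R n 1%g).
rewrite (_ : [set w | _] = order_event s); first by [].
apply/seteqP; split => w /= ws i j.
  by have := ws (s i) (s j); rewrite !permK !perm1.
by rewrite ws !permKV !perm1.
Qed.

(** Almost surely there are no ties, so exactly one order event occurs and [f] is a sum of constants
    times indicators; all these events are equally likely. *)
Lemma integral_order_event (n : nat) (f : T -> R) (c : 'S_n -> R) :
  measurable_fun [set: T] f -> (forall s, 0 <= c s) ->
  (forall s w, order_event s w -> f w = c s) ->
  (\int[P]_w (f w)%:E = (\sum_s c s)%:E * P (order_event (1%g : 'S_n)))%E.
Proof.
move=> mf c0 fc.
have mE (s : 'S_n) : measurable (order_event s) by have [] := @order_event_exchange n s.
have mcE (s : 'S_n) : measurable_fun [set: T]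
    (fun w => (c s)%:E * (\1_(order_event s) w)%:E)%E.
  by apply/measurable_EFinP; exact: measurable_funM.
rewrite (ae_eq_integral
  (fun w => \sum_s (c s)%:E * (\1_(order_event s) w)%:E)%E)//; last 3 first.
- exact/measurable_EFinP.
- exact: emeasurable_sum.
- have : \forall w \ae P, forall i j, i != j -> X i w <> X j w.
    apply/ae_foralln => i; apply/ae_foralln => j.
    have [->|ij] := eqVneq i j; first exact: aeW.
    exists [set w | X i w = X j w]; split; [|exact: prob_eq0|].
      have /(_ measurableT [set true]) := measurable_fun_eqr
        (measurable_funPT (X i)) (measurable_funPT (X j)).
      rewrite setTI (_ : _ @^-1` _ = [set w | X i w = X j w]); first by apply.
      by apply/seteqP; split => w /= /eqP.
    by move=> w /= /not_implyP[_ /contrapT].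
  apply: filterS => w X_neq _.
  have X_inj : injective (fun i : 'I_n => X i w).
    by move=> i j Xij; apply/val_inj/eqP; apply: contraPT Xij => /X_neq.
  have [s ws] := same_order_exists X_inj.
  rewrite (fc s w ws) (bigD1 s)//= indicE mem_set// mule1 big1 ?adde0// => t ts.
  rewrite indicE memNset ?mule0// => wt.
  by move/eqP: ts; apply; exact: same_order_inj wt ws.
rewrite ge0_integral_sum//; last first.
  by move=> s w _; rewrite mule_ge0// lee_fin.
rewrite -sumEFin ge0_sume_distrl; last by move=> s _; rewrite lee_fin.
apply: eq_bigr => s _.
rewrite ge0_integralZl//=; last by rewrite lee_fin.
  by rewrite integral_indic// setIT; congr (_ * _)%E; exact: (order_event_exchange s).2.
exact/measurable_EFinP/measurable_indic.
Qed.

(** Integrating the constant 1 yields [n! P = 1]. *)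
Lemma prob_order_event (n : nat) :
  P (order_event (1%g : 'S_n)) = (n`!%:R^-1)%:E.
Proof.
have := @integral_order_event n (cst 1) (fun=> 1) (measurable_cst _)
  (fun=> ler01) (fun _ _ _ => erefl).
have int1 : (\int[P]_w (cst 1 w)%:E = 1)%E.
  by rewrite (integral_cst P measurableT 1%:E) mul1e; exact: probability_setT.
rewrite int1 sumr_const card_Sn.
have : P (order_event (1%g : 'S_n)) \is a fin_num.
  by apply: fin_num_measure; have [] := order_event_exchange (1%g : 'S_n).
case: (P _) => // r _; rewrite -EFinM => -[] rE; congr _%:E.
have fact_neq0 : n`!%:R != 0 :> R by rewrite pnatr_eq0 -lt0n fact_gt0.
by apply: (mulfI fact_neq0); rewrite -rE mulfV.
Qed.

(** The count is a function of the finite table [M] of comparisons, so preimages are finite unions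
    of the events [F M]. Tables, unlike permutations, also cover samples with ties. *)
Lemma measurable_num_retained (p : R) (n : nat) :
  measurable_fun [set: T]
    (fun w => (num_retained p (fun i => X i w) n)%:R : R).
Proof.
move=> _ Y _; rewrite setTI.
pose F (M : {ffun 'I_n * 'I_n -> bool}) :=
  [set w | forall ij : 'I_n * 'I_n, (X ij.1 w <= X ij.2 w) = M ij].
rewrite [X in measurable X](_ : _ = \bigcup_(M in
  [set M | exists2 w, F M w & Y (num_retained p (fun i => X i w) n)%:R]) F M).
  apply: fin_bigcup_measurable => // M _.
  rewrite [F M](_ : _ = \bigcap_(ij in [set: 'I_n * 'I_n])
    [set w | (X ij.1 w <= X ij.2 w) = M ij]).
    apply: fin_bigcap_measurable => // ij _.
    have /(_ measurableT [set M ij]) := measurable_fun_ler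
      (measurable_funPT (X ij.1)) (measurable_funPT (X ij.2)).
    by rewrite setTI; apply.
  by apply/seteqP; split => w /= wM ij; [move=> _|]; exact: wM.
apply/seteqP; split => [w /= Yw|w [M [v vM Yv] wM] /=].
  exists [ffun ij : 'I_n * 'I_n => X ij.1 w <= X ij.2 w].
    by exists w => // ij; rewrite ffunE.
  by move=> ij; rewrite ffunE.
rewrite (_ : num_retained _ _ _ = num_retained p (fun i => X i v) n)//.
apply: eq_num_retained => i j lti ltj.
by have := wM (Ordinal lti, Ordinal ltj); rewrite -vM.
Qed.

Lemma expectation_num_retained (p : R) (n : nat) :
  ('E_P[fun w => (num_retained p (fun i => X i w) n)%:R])%E =
  ((\sum_(s : 'S_n) (num_retained p (perm_seq R s) n)%:R) / n`!%:R)%:E.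
Proof.
rewrite unlock (integral_order_event
  (c := fun s : 'S_n => (num_retained p (perm_seq R s) n)%:R)).
- by rewrite prob_order_event EFinM.
- exact: measurable_num_retained.
- by move=> s; exact: ler0n.
- by move=> s w sw; rewrite (num_retained_same_order p (x := fun i => X i w) sw).
Qed.

End iid.

(** * Convergence of the normalized expectation *)

Theorem theorem4p1 (R : realType) (p : R) (p_gt0 : 0 < p) (p_le1 : p <= 1) :
  exists c : R, 0 < c /\
    forall (d : measure_display) (T : measurableType d) (P : probability T R)
      (X : nat -> {RV P >-> R}),
      mutually_independent X ->
      identically_distributed X ->
      (forall n, continuous_distribution (X n)) ->
      ('E_P[fun w => (num_retained p (fun i => X i w) n)%:R]
        / (n%:R `^ p)%:E)%E @[n --> \oo] --> c%:E.
Proof.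
have p01 : 0 < p <= 1 by rewrite p_gt0.
(* This average involves no probability space, so the limit depends on [p] alone. *)
pose e n : R := (\sum_(s : 'S_n) (num_retained p (perm_seq R s) n)%:R) / n`!%:R.
have e1 : 0 < e 1%N.
  rewrite /e divr_gt0 ?ltr0n ?fact_gt0// -natr_sum ltr0n.
  by rewrite (bigD1 (1%g : 'S_1)).
have e_rec n : e n.+1 * (1 + p / n.+2%:R) <= e n.+2
    <= e n.+1 * (1 + p / n.+2%:R) + n.+2%:R^-1.
  rewrite /e sum_num_retained_rec// (factS n.+1) natrM.
  pose L (t : 'S_n.+1) : R := (num_retained p (perm_seq R t) n.+1)%:R.
  rewrite big_split /= -mulr_sumr.
  pose S := \sum_t L t; pose C := \sum_t (Num.ceil (p * L t))%:~R : R.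
  rewrite -!/S -!/C.
  set N : R := n.+2%:R; set F : R := n.+1`!%:R.
  have F0 : 0 < F by rewrite ltr0n fact_gt0.
  have N0 : 0 < N by [].
  have pS_le : p * S <= C.
    by rewrite mulr_sumr ler_sum// => t _; exact: ceil_ge.
  (* Each ceiling costs at most 1, and there are [F = (n+1)!] permutations. *)
  have C_le : C <= p * S + F.
    rewrite /F -card_Sn -sumr_const mulr_sumr -big_split ler_sum//= => t _.
    by have /andP[+ _] := ceil_itv (p * L t); rewrite rmorphB rmorph1 ltrBlDr => /ltW.
  have -> : (N * S + C) / (N * F) = S / F + C / (N * F).
    by field; rewrite !lt0r_neq0.
  have -> : S / F * (1 + p / N) = S / F + (p * S) / (N * F).
    by field; rewrite !lt0r_neq0.
  have -> : N^-1 = F / (N * F) by field; rewrite !lt0r_neq0.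
  have NFV : 0 <= (N * F)^-1 by rewrite invr_ge0 mulr_ge0// ltW.
  by rewrite -addrA -mulrDl !lerD2l !ler_wpM2r.
have [c c_gt0 e_cvg] := growth_limit p01 e1 e_rec.
exists c; split => // d T P X X_indep X_id X_cont.
under eq_fun do rewrite expectation_num_retained//.
(* The extended-real quotient is reduced to the real one for [n > 0], where the denominator is
   nonzero. *)
have eventually_fin : \forall n \near \oo,
    ((e n)%:E / (n%:R `^ p)%:E)%E = (e n / n%:R `^ p)%:E.
  near=> n.
  have n_gt0 : (0 < n)%N by near: n; exact: nbhs_infty_gt.
  by rewrite inver gt_eqF ?powR_gt0 ?ltr0n// -EFinM.
apply: cvg_EFin; first by apply: filterS eventually_fin => n ->.
apply: cvg_trans e_cvg; apply: near_eq_cvg.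
by apply: filterS eventually_fin => n /= ->.
Unshelve. all: by end_near. Qed.
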